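(* Let $a>0$ and let $\mu_p$ be the Poisson measure on $\mathbb{R}$ with parameter $a$. Let $\lambda_n=a^nn!$ and let $\mathcal{H}_\lambda$ be the Hilbert space of entire functions $F(z)=\sum_{n\ge0}a_nz^n$ with $\sum_{n\ge0}\lambda_n|a_n|^2<\infty$, normed by $\|F\|_{\mathcal{H}_\lambda}^2=\sum_{n\ge0}\lambda_n|a_n|^2$. Then there exists a unique measure $\widetilde\mu$ on $\mathbb{C}$ such that $\mathcal{H}_\lambda=\mathcal{H}L^2(\mathbb{C},\widetilde\mu)$, i.e. an entire function $F$ belongs to $\mathcal{H}_\lambda$ if and only if $F\in L^2(\mathbb{C},\widetilde\mu)$, and in that case $\|F\|_{\mathcal{H}_\lambda}^2=\int_{\mathbb{C}}|F(z)|^2\,d\widetilde\mu(z)$.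
   Context: The Poisson measure with parameter $a$ is $\mu_p=\sum_{k\ge0}e^{-a}\frac{a^k}{k!}\delta_k$. $\mathcal{H}L^2(\mathbb{C},\widetilde\mu)$ denotes the space of entire functions on $\mathbb{C}$ that are square integrable with respect to $\widetilde\mu$, with the $L^2(\widetilde\mu)$-norm. The sequence $\lambda_n=a^nn!$ is the sequence of squared norms $\int P_n^2\,d\mu_p$ of the monic orthogonal (Charlier) polynomials $P_n$ of $\mu_p$. *)

(* Defs.v *)
From HB Require Import structures.
From mathcomp Require Import all_boot all_order all_algebra.
From mathcomp Require Import complex.
From mathcomp Require Import all_classical all_reals all_analysis.
Set Implicit Arguments. Unset Strict Implicit. Unset Printing Implicit Defensive.
Import Order.TTheory GRing.Theory Num.Theory.
Import numFieldNormedType.Exports.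
Local Open Scope ring_scope.
Local Open Scope classical_set_scope.

(* The complex plane C = R[i]; it is identified with R * R (x + i y <-> (x,y))
   to carry the Borel (product) sigma-algebra. *)
Definition toC (R : realType) (p : R * R) : R[i] := Complex p.1 p.2.

Definition cabs2 (R : realType) (z : R[i]) : R := complex.Re z ^+ 2 + complex.Im z ^+ 2.

Definition lam (R : realType) (a : R) (n : nat) : R := a ^+ n * (n`!)%:R.

Definition entire_series (R : realType) (c : nat -> R[i]) (F : R[i] -> R[i]) :=
  forall z : R[i],
    ((fun N => complex.Re (\sum_(n < N) c n * z ^+ n)) : R^nat) @ \oo --> (complex.Re (F z) : R) /\
    ((fun N => complex.Im (\sum_(n < N) c n * z ^+ n)) : R^nat) @ \oo --> (complex.Im (F z) : R).

Definition Hnorm2 (R : realType) (a : R) (c : nat -> R[i]) : \bar R :=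
  (\sum_(0 <= n <oo) ((lam a n * cabs2 (c n))%:E))%E.

Definition inL2 (R : realType) (mu : {measure set (R * R) -> \bar R})
  (F : R[i] -> R[i]) : Prop :=
  measurable_fun setT (fun p => complex.Re (F (toC p))) /\
  measurable_fun setT (fun p => complex.Im (F (toC p))) /\
  (\int[mu]_p ((cabs2 (F (toC p)))%:E) < +oo)%E.

Definition HL2_equal (R : realType) (a : R) (mu : {measure set (R * R) -> \bar R}) : Prop :=
  forall (c : nat -> R[i]) (F : R[i] -> R[i]), entire_series c F ->
    ((Hnorm2 a c < +oo)%E <-> inL2 mu F) /\
    ((Hnorm2 a c < +oo)%E -> (Hnorm2 a c = \int[mu]_p ((cabs2 (F (toC p)))%:E))%E).

(* Main.v *)
(* Existence. Let [T] be exponential with parameter 1, [Theta] uniform on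
   [0, 2 pi], independent, and let [mu] be the law of
   [sqrt (a T) e^(i Theta)].  Parseval's identity on circles and Tonelli give
   [int |F|^2 dmu = sum |c_n|^2 a^n E(T^n) = sum a^n n! |c_n|^2] for every
   entire [F], both sides being possibly infinite.

   Uniqueness. For two such measures, polarization of the norms of
   [z^j + conj(w) z^k] shows that all [int Re (w z^j conj(z)^k)] agree, and
   summing the norms of monomials shows that [exp (|z|^2 / (2 a))] is integrable.
   Call [g] a multiplier if [f |-> f g] preserves the functions [f] of exponential
   growth for which all [int f Re (w z^j conj(z)^k)] agree.  Multipliers form an
   algebra closed under dominated pointwise limits.  It contains the coordinates
   [x] and [y], hence [sin (t (x - b))] by its power series, hence the sign of
   [sin (t (x - b))], as iterates of [u |-> (3 u - u^3) / 2] converge to the sign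
   on [-1, 1], hence the indicator of [x > b] (let [t] tend to 0), hence every
   Borel indicator. *)

Require Import Defs.
From HB Require Import structures.
From mathcomp Require Import all_boot all_order all_algebra.
From mathcomp Require Import complex.
From mathcomp Require Import all_classical all_reals all_analysis.
From mathcomp Require Import measurable_realfun.
From mathcomp Require Import ring lra.
Set Implicit Arguments. Unset Strict Implicit. Unset Printing Implicit Defensive.
Import Order.TTheory GRing.Theory Num.Theory.
Import numFieldNormedType.Exports.
Local Open Scope ring_scope.
Local Open Scope classical_set_scope.

(** * Exponential growth and moments *)

Section complex_parts.
Context {R : realType}.
Implicit Types z w : R[i].

Lemma Re_add z w : complex.Re (z + w) = complex.Re z + complex.Re w.
Proof. by case: z; case: w. Qed.

Lemma Im_add z w : complex.Im (z + w) = complex.Im z + complex.Im w.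
Proof. by case: z; case: w. Qed.

Lemma Re_mul z w :
  complex.Re (z * w) = complex.Re z * complex.Re w - complex.Im z * complex.Im w.
Proof. by case: z; case: w. Qed.

Lemma Im_mul z w :
  complex.Im (z * w) = complex.Re z * complex.Im w + complex.Im z * complex.Re w.
Proof. by case: z; case: w. Qed.

Lemma Re_conj z : complex.Re (z^*)%C = complex.Re z.
Proof. by case: z. Qed.

Lemma Im_conj z : complex.Im (z^*)%C = - complex.Im z.
Proof. by case: z. Qed.

Lemma cabs2M z w : cabs2 (z * w) = cabs2 z * cabs2 w.
Proof. by rewrite /cabs2 Re_mul Im_mul; ring. Qed.

Lemma cabs2X z n : cabs2 (z ^+ n) = cabs2 z ^+ n.
Proof.
elim: n => [|n ih]; first by rewrite /cabs2 /= expr1n expr0n addr0.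
by rewrite !exprS cabs2M ih.
Qed.

Lemma cabs2_ge0 z : 0 <= cabs2 z.
Proof. by rewrite addr_ge0 ?sqr_ge0. Qed.

Lemma cabs2D z w :
  cabs2 (z + w) = cabs2 z + cabs2 w + 2 * complex.Re (z * (w^*)%C).
Proof. by rewrite /cabs2 Re_mul Re_conj Im_conj Re_add Im_add; ring. Qed.

End complex_parts.

Section growth.
Context {R : realType}.
Implicit Types f g : R * R -> R.

(** The bound is stable under sums and products. The sum of the absolute values of the coordinates
    serves as the norm because the exponent then splits into one-variable terms, each dominated by a
    Gaussian exponent. *)
Definition tempered f := exists C r : R, [/\ 0 <= C, 0 <= r &
  forall p, `|f p| <= C * expR (r * (`|p.1| + `|p.2|))].

Definition growth f := measurable_fun setT f /\ tempered f.

Lemma growth_cst c : growth (fun=> c).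
Proof.
split; first exact: measurable_cst.
by exists `|c|, 0; split=> // p; rewrite mul0r expR0 mulr1.
Qed.

Lemma growthD f g : growth f -> growth g -> growth (fun p => f p + g p).
Proof.
move=> [mf [C [r [C0 r0 fb]]]] [mg [D [s [D0 s0 gb]]]]; split.
  exact: measurable_funD.
exists (C + D), (r + s); split; [exact: addr_ge0|exact: addr_ge0|move=> p].
rewrite (le_trans (ler_normD _ _))// mulrDl lerD//.
- rewrite (le_trans (fb p))// ler_wpM2l// ler_expR ler_wpM2r ?addr_ge0//.
  by rewrite lerDl.
- rewrite (le_trans (gb p))// ler_wpM2l// ler_expR ler_wpM2r ?addr_ge0//.
  by rewrite lerDr.
Qed.

Lemma growthM f g : growth f -> growth g -> growth (fun p => f p * g p).
Proof.
move=> [mf [C [r [C0 r0 fb]]]] [mg [D [s [D0 s0 gb]]]]; split.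
  exact: measurable_funM.
exists (C * D), (r + s); split; [exact: mulr_ge0|exact: addr_ge0|move=> p].
by rewrite normrM mulrDl expRD mulrACA ler_pM.
Qed.

Lemma growth_coord (u : R * R -> R) : measurable_fun setT u ->
  (forall p, `|u p| <= `|p.1| + `|p.2|) -> growth u.
Proof.
move=> mu ub; split => //; exists 1, 1; split => // p.
rewrite !mul1r (le_trans (ub p))// (le_trans _ (expR_ge1Dx _))//.
by rewrite lerDr.
Qed.

Lemma growth_fst : growth (fst : R * R -> R).
Proof. by apply: growth_coord => [|p]; rewrite ?lerDl. Qed.

Lemma growth_snd : growth (snd : R * R -> R).
Proof. by apply: growth_coord => [|p]; rewrite ?lerDr. Qed.

(** The factor [w] lets real parts alone carry all the information: [w = 1] and [w = -i] give the
    real and the imaginary part of [z^j conj(z)^k]. *)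
Definition zmon (w : R[i]) (j k : nat) (p : R * R) : R[i] :=
  w * toC p ^+ j * ((toC p)^*)%C ^+ k.

Lemma growth_zmon w j k : growth (fun p => complex.Re (zmon w j k p)) /\
  growth (fun p => complex.Im (zmon w j k p)).
Proof.
(* Multiplication by [z] ([s = 1]) or by [conj z] ([s = -1]) mixes real and imaginary parts, so the
   induction carries both. *)
have G (F : R * R -> R[i]) (s : R) :
    growth (fun p => complex.Re (F p)) /\ growth (fun p => complex.Im (F p)) ->
    growth (fun p => complex.Re (F p * Complex p.1 (s * p.2))) /\
    growth (fun p => complex.Im (F p * Complex p.1 (s * p.2))).
  move=> [Fr Fi]; split.
  - have -> : (fun p => complex.Re (F p * Complex p.1 (s * p.2))) =
      (fun p => complex.Re (F p) * p.1 + (- s) * (complex.Im (F p) * p.2)).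
      by apply/funext => p; rewrite Re_mul /=; ring.
    apply: growthD; first exact: growthM growth_fst.
    by apply: growthM; [exact: growth_cst|exact: growthM growth_snd].
  - have -> : (fun p => complex.Im (F p * Complex p.1 (s * p.2))) =
      (fun p => s * (complex.Re (F p) * p.2) + complex.Im (F p) * p.1).
      by apply/funext => p; rewrite Im_mul /=; ring.
    apply: growthD; last exact: growthM growth_fst.
    by apply: growthM; [exact: growth_cst|exact: growthM growth_snd].
elim: k => [|k ih].
  elim: j => [|j ih].
    have -> : zmon w 0 0 = fun=> w by apply/funext => p; rewrite /zmon !mulr1.
    by split; exact: growth_cst.
  have -> : zmon w j.+1 0 = fun p => zmon w j 0 p * Complex p.1 (1 * p.2).
    by apply/funext => p; rewrite /zmon !mulr1 exprSr mulrA mul1r.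
  exact: G.
have -> : zmon w j k.+1 = fun p => zmon w j k p * Complex p.1 (-1 * p.2).
  by apply/funext => p; rewrite /zmon exprSr mulrA mulN1r.
exact: G.
Qed.

End growth.

(** * Real series and an iteration converging to the sign *)

Section real_series.
Context {R : realType}.

Lemma exp_coeff_ge0 (x : R) n : 0 <= x -> 0 <= exp_coeff x n.
Proof. by move=> x0; rewrite divr_ge0// exprn_ge0. Qed.

Lemma expR_nneseries (x : R) : 0 <= x ->
  ((expR x)%:E = \sum_(0 <= n <oo) (exp_coeff x n)%:E)%E.
Proof.
move=> x0; apply/esym/cvg_lim => //.
under eq_fun do rewrite sumEFin.
apply: cvg_EFin; first by apply: nearW => ?.
exact: is_cvg_series_exp_coeff.
Qed.

(** The map [phi y = (3 y - y^3) / 2] is odd and satisfies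
    [1 - phi v = (1 - (v + v^2) / 2) (1 - v)]. On []0, 1]] orbits increase, so the contraction
    factor never exceeds its value at the starting point and the distance to 1 decays
    geometrically. *)
Lemma sgr_iter_cvg (x : R) : `|x| <= 1 ->
  (iter n (fun y : R => 2^-1 * (3 * y - y ^+ 3)) x @[n --> \oo] --> Num.sg x) /\
  forall n, `|iter n (fun y : R => 2^-1 * (3 * y - y ^+ 3)) x| <= 1.
Proof.
pose phi (y : R) := 2^-1 * (3 * y - y ^+ 3); rewrite -/phi.
have phiN y : phi (- y) = - phi y by rewrite /phi; field.
have pos y : 0 < y -> y <= 1 -> forall n, [/\ y <= iter n phi y, iter n phi y <= 1 &
    1 - iter n phi y <= (1 - (y + y ^+ 2) / 2) ^+ n * (1 - y)].
  move=> y0 y1; elim=> [|n [h1 h2 h3]]; first by rewrite expr0 mul1r.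
  rewrite iterS; set v := iter n phi y in h1 h2 h3 *.
  have v0 : 0 < v by exact: lt_le_trans h1.
  have E : 1 - phi v = (1 - (v + v ^+ 2) / 2) * (1 - v) by rewrite /phi; field.
  have k : (v + v ^+ 2) / 2 <= 1 by rewrite expr2; nra.
  have vphi : v <= phi v.
    rewrite -(lerN2 (phi v)) -(lerD2l 1) E; rewrite -[leRHS]mul1r ler_wpM2r ?subr_ge0//.
    by rewrite lerBlDr lerDl divr_ge0// addr_ge0 ?sqr_ge0// ltW.
  split; first exact: le_trans vphi.
    by rewrite -subr_ge0 E mulr_ge0// subr_ge0.
  rewrite E [_ ^+ n.+1]exprS -[leRHS]mulrA ler_pM ?subr_ge0// lerB// ler_pM2r ?invr_gt0//.
  by rewrite lerD// lerXn2r// nnegrE ltW.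
have poscvg y : 0 < y -> y <= 1 -> iter n phi y @[n --> \oo] --> (1 : R).
  move=> y0 y1; pose rho := 1 - (y + y ^+ 2) / 2.
  have rho01 : `|rho| < 1.
    rewrite ger0_norm /rho ?subr_ge0; last by rewrite expr2; nra.
    by rewrite ltrBlDr ltrDl divr_gt0// addr_gt0// exprn_gt0.
  have H : rho ^+ n * (1 - y) @[n --> \oo] --> (0 : R).
    rewrite -[X in _ --> X](mul0r (1 - y)); apply: cvgMr_tmp.
    exact: cvg_expr.
  have : (1 - iter n phi y) @[n --> \oo] --> (0 : R).
    apply: (squeeze_cvgr _ (cvg_cst 0) H); apply: nearW => n.
    by have [_ h2 ->] := pos y y0 y1 n; rewrite subr_ge0 h2.
  move=> H1; rewrite -[X in _ --> X](subr0 1).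
  under eq_fun do rewrite -[iter _ _ _](subKr 1).
  by apply: cvgB => //; exact: cvg_cst.
have iterN n y : iter n phi (- y) = - iter n phi y.
  by elim: n => //= n ->; rewrite phiN.
have iter0 n : iter n phi 0 = 0.
  by elim: n => //= n ->; rewrite /phi mulr0 expr0n subr0 mulr0.
have posle y n : 0 < y -> y <= 1 -> `|iter n phi y| <= 1.
  move=> y0 y1; have [h1 h2 _] := pos y y0 y1 n.
  by rewrite ger0_norm// (le_trans _ h1)// ltW.
case: (ltrgt0P x) => [x0 x1|x0 x1|-> _].
- by rewrite gtr0_sg//; split=> [|n]; [exact: poscvg|exact: posle].
- rewrite ltr0_sg//; have xN : 0 < - x by rewrite oppr_gt0.
  rewrite -(opprK x); split=> [|n]; last by rewrite iterN normrN posle.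
  under eq_fun do rewrite iterN.
  by apply: cvgN; exact: poscvg.
- rewrite sgr0; under eq_fun do rewrite iter0.
  by split; [exact: cvg_cst|move=> n; rewrite iter0 normr0].
Qed.

End real_series.

(** * Polynomial norms and exponential integrability *)

Section moments.
Context {R : realType} (a : R) (ha : 0 < a).
Variables (mu : {measure set (R * R) -> \bar R}).
Hypothesis muE : HL2_equal a mu.

Lemma entire_poly (N : nat) (c : nat -> R[i]) : (forall n, (N <= n)%N -> c n = 0) ->
  entire_series c (fun z => \sum_(n < N) c n * z ^+ n).
Proof.
move=> c0 z.
have E : \forall n \near \oo,
    \sum_(i < n) c i * z ^+ i = \sum_(i < N) c i * z ^+ i.
  near=> n; have Nn : (N <= n)%N by near: n; exact: nbhs_infty_ge.
  rewrite -(subnKC Nn) big_split_ord /= [X in _ + X]big1 ?addr0// => i _.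
  by rewrite c0 ?mul0r// leq_addr.
by split; apply: cvg_near_cst; apply: filterS E => n ->.
Unshelve. all: by end_near. Qed.

Lemma lam_ge0 n : 0 <= lam a n.
Proof. by rewrite mulr_ge0 ?exprn_ge0// ltW. Qed.

Lemma Hnorm2_fin (N : nat) (c : nat -> R[i]) : (forall n, (N <= n)%N -> c n = 0) ->
  Hnorm2 a c = (\sum_(0 <= n < N) lam a n * cabs2 (c n))%:E.
Proof.
move=> c0; rewrite /Hnorm2 (nneseries_split 0 N)//; last first.
  by move=> k _; rewrite lee_fin mulr_ge0 ?lam_ge0 ?cabs2_ge0.
rewrite [X in (_ + X)%E]eseries0 ?adde0; last first.
  by move=> n; rewrite add0n => Nn _; rewrite c0// /cabs2 /= expr0n addr0 mulr0.
by rewrite add0n sumEFin.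
Qed.

(** The coefficient norm of a polynomial is finite, so [HL2_equal] turns it into the integral. The
    uniqueness argument uses [HL2_equal] in this form. *)
Lemma poly_norm (N : nat) (c : nat -> R[i]) : (forall n, (N <= n)%N -> c n = 0) ->
  (\int[mu]_p (cabs2 (\sum_(n < N) c n * toC p ^+ n))%:E =
   (\sum_(0 <= n < N) lam a n * cabs2 (c n))%:E)%E.
Proof.
move=> c0; have [_ /(_ _)] := muE (entire_poly c0).
by rewrite (Hnorm2_fin c0) => <-//; exact: ltry.
Qed.

Lemma mono_norm n : (\int[mu]_p (cabs2 (toC p) ^+ n)%:E = (lam a n)%:E)%E.
Proof.
pose c i : R[i] := (i == n)%:R.
have c0 k : (n.+1 <= k)%N -> c k = 0 by move=> nk; rewrite /c gtn_eqF.
have := poly_norm c0; rewrite big_nat_recr//= big_nat big1 ?add0r; last first.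
  by move=> i /andP[_ ni]; rewrite /c ltn_eqF//= /cabs2 /= expr0n addr0 mulr0.
rewrite /c eqxx /= {2}/cabs2 /= expr1n expr0n addr0 mulr1 => <-.
apply: eq_integral => p _; rewrite big_ord_recr/= big1 ?add0r; last first.
  by move=> i _; rewrite ltn_eqF ?mul0r// ltn_ord.
by rewrite eqxx mul1r cabs2X.
Qed.

Let q (p : R * R) : R := (2 * a)^-1 * cabs2 (toC p).

Let q_ge0 p : 0 <= q p.
Proof. by rewrite mulr_ge0 ?cabs2_ge0// invr_ge0 mulr_ge0// ltW. Qed.

Lemma measurable_cabs2_toC : measurable_fun setT (fun p : R * R => cabs2 (toC p)).
Proof.
apply: (@measurable_funD _ _ _ setT (fun p : R * R => p.1 ^+ 2) (fun p => p.2 ^+ 2)).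
  by apply: (@measurable_funX _ _ _ setT fst); exact: measurable_fst.
by apply: (@measurable_funX _ _ _ setT snd); exact: measurable_snd.
Qed.

(** Integrating the exponential series term by term, the [n]-th term is [(2 a)^(-n) / n!] times the
    moment [a^n n!], that is [2^(-n)]. The sum is a convergent geometric series. *)
Lemma integrable_gauss :
  mu.-integrable setT (fun p => (expR (q p))%:E).
Proof.
have mq : measurable_fun setT q.
  by apply: measurable_funM => //; exact: measurable_cabs2_toC.
apply/integrableP; split.
  by apply/measurable_EFinP; exact: measurableT_comp.
under eq_integral do rewrite gee0_abs ?lee_fin ?expR_ge0// expR_nneseries//.
rewrite integral_nneseries//; last 2 first.
- move=> n; apply/measurable_EFinP; apply: measurable_funM => //.
  exact: measurable_funX.
- by move=> n p _; rewrite lee_fin exp_coeff_ge0.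
have E n : (\int[mu]_p (exp_coeff (q p) n)%:E = (geometric 1 2^-1 n)%:E)%E.
  have -> : (geometric 1 2^-1 n)%:E =
      (((2 * a)^-1 ^+ n / n`!%:R)%:E * (lam a n)%:E)%E.
    rewrite -EFinM /lam /= mul1r invfM exprMn mulrACA (exprVn a).
    rewrite -!mulrA [X in 2^-1 ^+ n * X](_ : _ = 1) ?mulr1//.
    have n0 : n`!%:R != 0 :> R by rewrite pnatr_eq0 -lt0n fact_gt0.
    by field; rewrite n0 ?expf_neq0// gt_eqF.
  rewrite -mono_norm -ge0_integralZl//; last 3 first.
  - apply/measurable_EFinP; apply: measurable_funX.
    exact: measurable_cabs2_toC.
  - by move=> p _; rewrite lee_fin exprn_ge0// cabs2_ge0.
  - by rewrite lee_fin divr_ge0// exprn_ge0// invr_ge0 mulr_ge0// ltW.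
  apply: eq_integral => p _; rewrite -EFinM /exp_coeff /= /q exprMn.
  by rewrite mulrAC.
under eq_eseriesr do rewrite E.
have [h|] := pselect (cvgn (series (geometric (1:R) 2^-1))).
  have /cvg_lim -> // : (fun n => \sum_(0 <= k < n) (geometric (1:R) 2^-1 k)%:E)%E
     @ \oo --> (limn (series (geometric (1:R) 2^-1)))%:E.
    under eq_fun do rewrite sumEFin.
    by apply: cvg_EFin; [exact: nearW|exact: h].
  exact: ltry.
case; apply: is_cvg_geometric_series.
by rewrite ger0_norm ?invr_ge0// invf_lt1// ltr1n.
Qed.

Lemma growth_integrable f : growth f -> mu.-integrable setT (fun p => (f p)%:E).
Proof.
move=> [mf [C [r [C0 r0 fb]]]].
have I : mu.-integrable setT (fun p => ((C * expR (a * r ^+ 2))%:E * (expR (q p))%:E)%E).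
  by apply: integrableZl => //; exact: integrable_gauss.
apply: le_integrable I => //; first exact/measurable_EFinP.
move=> p _; rewrite -EFinM /= !lee_fin (le_trans (fb p))// [leRHS]ger0_norm; last first.
  by rewrite !mulr_ge0// expR_ge0.
rewrite -mulrA -expRD ler_wpM2l// ler_expR /q /cabs2/=.
(* The difference of the two sides is the square [(a r - |x|)^2 / (2 a)]. Adding the inequalities
   for both coordinates produces the constant [expR (a * r ^+ 2)] chosen above. *)
have H (x : R) : r * `|x| <= a * r ^+ 2 / 2 + (2 * a)^-1 * x ^+ 2.
  rewrite -subr_ge0 -(real_normK (num_real x)).
  have -> : a * r ^+ 2 / 2 + (2 * a)^-1 * `|x| ^+ 2 - r * `|x| =
      (2 * a)^-1 * (a * r - `|x|) ^+ 2.
    by field; rewrite gt_eqF.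
  by rewrite mulr_ge0 ?sqr_ge0// invr_ge0 mulr_ge0// ltW.
by have := lerD (H p.1) (H p.2); nra.
Qed.

End moments.

(** * Uniqueness *)

Section uniqueness.
Context {R : realType} (a : R) (ha : 0 < a).
Variables mu nu : {measure set (R * R) -> \bar R}.
Hypotheses (muE : HL2_equal a mu) (nuE : HL2_equal a nu).
Implicit Types f g u : R * R -> R.

Definition agree f := (\int[mu]_p (f p)%:E = \int[nu]_p (f p)%:E)%E.

Let growth_mu f (gf : growth f) := growth_integrable ha muE gf.
Let growth_nu f (gf : growth f) := growth_integrable ha nuE gf.

Lemma agreeD f g : growth f -> growth g -> agree f -> agree g ->
  agree (fun p => f p + g p).
Proof.
move=> gf gg fE gE; rewrite /agree.
under eq_integral do rewrite EFinD.
under [RHS]eq_integral do rewrite EFinD.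
rewrite !integralD//; try solve [exact: growth_mu|exact: growth_nu].
by rewrite fE gE.
Qed.

Lemma agreeZ c f : growth f -> agree f -> agree (fun p => c * f p).
Proof.
move=> gf fE; rewrite /agree.
under eq_integral do rewrite EFinM.
under [RHS]eq_integral do rewrite EFinM.
rewrite !integralZl//; try solve [exact: growth_mu|exact: growth_nu].
by rewrite fE.
Qed.

(** A dominating function of exponential growth is integrable for both measures. Dominated
    convergence then makes both integrals of [f] limits of the same sequence. *)
Lemma agree_lim (f_ : nat -> R * R -> R) f :
  (forall n, growth (f_ n)) -> (forall n, agree (f_ n)) ->
  (exists2 g, growth g & forall n p, `|f_ n p| <= g p) ->
  (forall p, f_ ^~ p @ \oo --> f p) -> agree f.
Proof.
move=> gf fE [g gg fg] ff.
have mf : measurable_fun setT f.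
  by apply: (measurable_fun_cvg (h := f_)) => // n; case: (gf n).
have D (m : {measure set (R * R) -> \bar R}) :
    m.-integrable setT (fun p => (g p)%:E) ->
    ((\int[m]_p (f_ n p)%:E)%E @[n --> \oo] --> (\int[m]_p (f p)%:E)%E).
  move=> ig.
  have [] // := @dominated_convergence _ _ _ m setT measurableT
    (fun n p => (f_ n p)%:E) (fun p => (f p)%:E) (fun p => (g p)%:E).
  - by move=> n; apply/measurable_EFinP; case: (gf n).
  - exact/measurable_EFinP.
  - apply: aeW => p _ /=; apply: cvg_EFin; first by apply: nearW => ?.
    exact: ff.
  - by apply: aeW => p n _; rewrite /= lee_fin.
have Dmu := D _ (growth_mu gg); have Dnu := D _ (growth_nu gg).
have E : (fun n => \int[mu]_p (f_ n p)%:E)%E = (fun n => \int[nu]_p (f_ n p)%:E)%E.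
  by apply/funext => n; exact: fE.
rewrite E in Dmu.
by rewrite /agree -(cvg_lim _ Dmu)// -(cvg_lim _ Dnu).
Qed.

(** Polarization: in [|z^j + conj(w) z^k|^2] the cross term is [2 Re (w z^j conj(z)^k)], while the
    square and the two remaining terms have integrals fixed by the norms of polynomials. *)
Lemma agree_zmon w j k : agree (fun p => complex.Re (zmon w j k p)).
Proof.
(* Adding the two contributions also covers [j = k], where they fall on the same coefficient. *)
pose c i : R[i] := (i == j)%:R + (i == k)%:R * (w^*)%C.
pose N := (maxn j k).+1.
have c0 n : (N <= n)%N -> c n = 0.
  by move=> Nn; rewrite /c !gtn_eqF ?mul0r ?addr0// (leq_trans _ Nn)// ltnS
    ?leq_maxl ?leq_maxr.
have pick (i : nat) (z : R[i]) : (i < N)%N ->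
    \sum_(n < N) (n == i :> nat)%:R * z ^+ n = z ^+ i.
  move=> iN; rewrite (bigD1 (Ordinal iN))//= eqxx mul1r big1 ?addr0// => n.
  by rewrite -val_eqE /= => /negbTE ->; rewrite mul0r.
have jN : (j < N)%N by rewrite ltnS leq_maxl.
have kN : (k < N)%N by rewrite ltnS leq_maxr.
have P p : \sum_(n < N) c n * toC p ^+ n = toC p ^+ j + (w^*)%C * toC p ^+ k.
  rewrite /c; under eq_bigr do rewrite mulrDl -mulrA mulrCA.
  by rewrite big_split/= pick// -mulr_sumr pick.
pose h p := cabs2 (toC p ^+ j + (w^*)%C * toC p ^+ k).
have gcabs : growth (fun p : R * R => cabs2 (toC p)).
  rewrite [X in growth X](_ : _ = fun p => p.1 * p.1 + p.2 * p.2); last first.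
    by apply/funext => p; rewrite /cabs2 /= !expr2.
  by apply: growthD; apply: growthM; (exact: growth_fst || exact: growth_snd).
have gX n : growth (fun p : R * R => cabs2 (toC p) ^+ n).
  elim: n => [|n ih]; first exact: growth_cst.
  by under eq_fun do rewrite exprS; exact: growthM.
have [gz _] := growth_zmon w j k.
have hE p : h p = cabs2 (toC p) ^+ j + cabs2 w * cabs2 (toC p) ^+ k +
    2 * complex.Re (zmon w j k p).
  rewrite /h cabs2D cabs2M !cabs2X; congr (_ + _ * _ + 2 * complex.Re _).
    by rewrite /cabs2 Re_conj Im_conj sqrrN.
  by rewrite /zmon rmorphM rmorphXn /= conjcK mulrA (mulrC w).
have gh : growth h.
  have -> : h = fun p => cabs2 (toC p) ^+ j + cabs2 w * cabs2 (toC p) ^+ k +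
    2 * complex.Re (zmon w j k p) by apply/funext.
  by do 2?apply: growthD => //; apply: growthM => //; exact: growth_cst.
have ah : agree h.
  have := poly_norm ha muE c0; rewrite -(poly_norm ha nuE c0) => H.
  rewrite /agree /h; under eq_integral do rewrite -P.
  by rewrite H; apply: eq_integral => p _; rewrite P.
have -> : (fun p => complex.Re (zmon w j k p)) = fun p => 2^-1 * (h p +
   ((-1) * cabs2 (toC p) ^+ j + (- cabs2 w) * cabs2 (toC p) ^+ k)).
  by apply/funext => p; rewrite hE; field.
have gM (s : R) n : growth (fun p : R * R => s * cabs2 (toC p) ^+ n).
  by apply: growthM => //; exact: growth_cst.
have aX n : agree (fun p : R * R => cabs2 (toC p) ^+ n).
  by rewrite /agree (mono_norm ha muE) (mono_norm ha nuE).
have aM (s : R) n : agree (fun p : R * R => s * cabs2 (toC p) ^+ n).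
  by apply: agreeZ; [exact: gX|exact: aX].
have gs : growth (fun p : R * R =>
    -1 * cabs2 (toC p) ^+ j + - cabs2 w * cabs2 (toC p) ^+ k).
  by apply: growthD; exact: gM.
apply: agreeZ; first exact: growthD.
by apply: agreeD => //; apply: agreeD; [exact: gM|exact: gM|exact: aM|exact: aM].
Qed.

(** The complex-moment functionals of [f mu] and [f nu] coincide. *)
Definition mtest f := growth f /\
  forall w j k, agree (fun p => f p * complex.Re (zmon w j k p)).

(** Asking for stability of all test functions, rather than for one equality of integrals, makes
    closure under products a mere composition. *)
Definition multiplier g := growth g /\
  forall f, mtest f -> mtest (fun p => f p * g p).

Let gzmon w j k : growth (fun p : R * R => complex.Re (zmon w j k p)).
Proof. by case: (growth_zmon w j k). Qed.

Lemma multiplier_cst c : multiplier (fun=> c).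
Proof.
split=> [|f [gf fE]]; first exact: growth_cst.
split=> [|w j k]; first by apply: growthM => //; exact: growth_cst.
have -> : (fun p => f p * c * complex.Re (zmon w j k p)) =
    fun p => c * (f p * complex.Re (zmon w j k p)).
  by apply/funext => p; ring.
by apply: agreeZ; [exact: growthM|exact: fE].
Qed.

Lemma multiplierD f g : multiplier f -> multiplier g ->
  multiplier (fun p => f p + g p).
Proof.
move=> [gf fm] [gg gm]; split=> [|h hh]; first exact: growthD.
have [gh _] := hh; split=> [|w j k]; first by apply: growthM => //; exact: growthD.
under [X in agree X]eq_fun do rewrite mulrDr mulrDl.
have [? ?] := fm _ hh; have [? ?] := gm _ hh.
by apply: agreeD => //; apply: growthM.
Qed.

Lemma multiplierM f g : multiplier f -> multiplier g ->
  multiplier (fun p => f p * g p).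
Proof.
move=> [gf fm] [gg gm]; split=> [|h hh]; first exact: growthM.
by under [X in mtest X]eq_fun do rewrite mulrA; exact/gm/fm.
Qed.

(** The dominating [g] also bounds the pointwise limit, which therefore has exponential growth.
    Multiplying the bound by [|h|] and by the monomial gives the domination required by
    [agree_lim]. *)
Lemma multiplier_lim (f_ : nat -> R * R -> R) f :
  (forall n, multiplier (f_ n)) ->
  (exists2 g, growth g & forall n p, `|f_ n p| <= g p) ->
  (forall p, f_ ^~ p @ \oo --> f p) -> multiplier f.
Proof.
move=> fm [g gg fg] ff.
have gf : growth f.
  split; first by apply: (measurable_fun_cvg (h := f_)) => // n; case: (fm n) => -[].
  case: gg => mg [C [r [C0 r0 gb]]]; exists C, r; split => // p.
  apply: le_trans (gb p); apply: le_trans (ler_norm _).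
  apply: (cvgr_to_le (cvg_norm (ff p))).
  by apply: nearW => n; rewrite (le_trans (fg n p))// ler_norm.
split=> // h hh; have [gh _] := hh.
have gabs (u : R * R -> R) : growth u -> growth (fun p => `|u p|).
  move=> [mu' [C [r [C0 r0 ub]]]]; split; first exact: measurableT_comp.
  by exists C, r; split=> // p; rewrite normr_id.
split=> [|w j k]; first exact: growthM.
apply: (@agree_lim (fun n p => h p * f_ n p * complex.Re (zmon w j k p))).
- by move=> n; apply: growthM => //; apply: growthM => //; case: (fm n).
- by move=> n; have [_ /(_ _ hh)[]] := fm n.
- exists (fun p => `|h p| * `|g p| * `|complex.Re (zmon w j k p)|).
    by apply: growthM; [apply: growthM|]; apply: gabs.
  by move=> n p; rewrite !normrM ler_wpM2r// ler_wpM2l// (le_trans (fg n p))// ler_norm.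
- by move=> p; apply: cvgMr_tmp; apply: cvgMl_tmp; exact: ff.
Qed.

(* [Re A * Re B = (Re (A * B) + Re (A * conj B)) / 2] with [A = w z^j conj(z)^k]
   and [B = s z], for [s = 1] and [s = -i]. *)
Lemma multiplier_Re s : multiplier (fun p => complex.Re (s * toC p)).
Proof.
have g1 : growth (fun p : R * R => complex.Re (s * toC p)).
  have -> : (fun p => complex.Re (s * toC p)) = fun p => complex.Re (zmon s 1 0 p).
    by apply/funext => p; rewrite /zmon expr1 mulr1.
  exact: gzmon.
split=> // f [gf fE]; split=> [|w j k]; first exact: growthM.
have -> : (fun p => f p * complex.Re (s * toC p) * complex.Re (zmon w j k p)) =
  fun p => 2^-1 * (f p * complex.Re (zmon (w * s) j.+1 k p) +
                   f p * complex.Re (zmon (w * (s^*)%C) j k.+1 p)).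
  apply/funext => p.
  have -> : zmon (w * s) j.+1 k p = zmon w j k p * (s * toC p).
    by rewrite /zmon exprS; ring.
  have -> : zmon (w * (s^*)%C) j k.+1 p = zmon w j k p * ((s * toC p)^*)%C.
    by rewrite /zmon exprS rmorphM /=; ring.
  rewrite (Re_mul (zmon w j k p) (s * toC p)).
  rewrite (Re_mul (zmon w j k p) ((s * toC p)^*)%C) Re_conj Im_conj.
  by field.
apply: agreeZ; first by apply: growthD; apply: growthM.
by apply: agreeD => //; apply: growthM.
Qed.

Lemma multiplier_fst : multiplier fst.
Proof.
have := multiplier_Re 1; congr multiplier.
by apply/funext => p; rewrite mul1r.
Qed.

Lemma multiplier_snd : multiplier snd.
Proof.
have := multiplier_Re (Complex 0 (-1)); congr multiplier.
by apply/funext => p; rewrite Re_mul /=; ring.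
Qed.

Lemma multiplierX f n : multiplier f -> multiplier (fun p => f p ^+ n).
Proof.
move=> fm; elim: n => [|n ih]; first exact: multiplier_cst.
by under eq_fun do rewrite exprS; exact: multiplierM.
Qed.

Lemma multiplier_sum (f_ : nat -> R * R -> R) n : (forall i, multiplier (f_ i)) ->
  multiplier (fun p => \sum_(0 <= i < n) f_ i p).
Proof.
move=> fm; elim: n => [|n ih].
  by under eq_fun do rewrite big_geq//; exact: multiplier_cst.
by under eq_fun do rewrite big_nat_recr//=; exact: multiplierD.
Qed.

(** * Borel sets in one coordinate [u], later [fst] or [snd] *)

Section coordinate.
Variable u : R * R -> R.
Hypotheses (um : multiplier u) (ub : forall p, `|u p| <= `|p.1| + `|p.2|).

Lemma multiplier_sin t b : multiplier (fun p => sin (t * (u p - b))).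
Proof.
have lm : multiplier (fun p => t * (u p - b)).
  apply: multiplierM; first exact: multiplier_cst.
  by apply: multiplierD => //; exact: multiplier_cst.
apply: (@multiplier_lim (fun n p => series (sin_coeff (t * (u p - b))) n)).
- move=> n; apply: multiplier_sum => i.
  apply: multiplierM; last exact: multiplier_cst.
  by apply: multiplierM; [exact: multiplier_cst|exact: multiplierX].
(* This majorant is [exp] of an upper bound of [|t (u p - b)|]. The sine partial sums are bounded
   term by term by those of [exp |x|], which increase to [exp |x|]. *)
- exists (fun p => expR (`|t| * `|b|) * expR (`|t| * (`|p.1| + `|p.2|))).
    split.
      apply: measurable_funM => //; apply: measurableT_comp => //.
      apply: measurable_funM => //; apply: measurable_funD; apply: measurableT_comp => //.
    exists (expR (`|t| * `|b|)), `|t|; split; rewrite ?expR_ge0// => p.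
    by rewrite ger0_norm// mulr_ge0 ?expR_ge0.
  move=> n p; set x := t * _.
  apply: (@le_trans _ _ (expR `|x|)); last first.
    rewrite -expRD ler_expR -mulrDr /x normrM ler_wpM2l//.
    by rewrite (le_trans (ler_normB _ _))// addrC lerD2l.
  apply: (@le_trans _ _ (series (exp_coeff `|x|) n)); last first.
    apply: nondecreasing_cvgn_le; last exact: is_cvg_series_exp_coeff.
    by apply: nondecreasing_series => i _ _; exact: exp_coeff_ge0.
  rewrite /series/= (le_trans (ler_norm_sum _ _ _))// ler_sum// => i _.
  rewrite /sin_coeff /exp_coeff /= !normrM normfV !normr_nat.
  rewrite !normrX normrN normr1 expr1n mulr1 -normrM -/x.
  by case: odd; [rewrite mul1r|rewrite !mul0r divr_ge0// exprn_ge0].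
- by move=> p; rewrite sin.unlock; exact: is_cvg_series_sin_coeff.
Qed.

(** Each iterate is a polynomial in [g], hence a multiplier. The bound [|g| <= 1] gives both the
    convergence and the constant majorant 1. *)
Lemma multiplier_sg g : multiplier g -> (forall p, `|g p| <= 1) ->
  multiplier (fun p => Num.sg (g p)).
Proof.
move=> gm gb.
apply: (@multiplier_lim (fun n p => iter n (fun y : R => 2^-1 * (3 * y - y ^+ 3)) (g p))).
- elim => [//|n ih] /=.
  apply: multiplierM; first exact: multiplier_cst.
  apply: multiplierD; first by apply: multiplierM => //; exact: multiplier_cst.
  under eq_fun do rewrite -mulN1r.
  by apply: multiplierM; [exact: multiplier_cst|exact: multiplierX].
- by exists (fun=> 1); [exact: growth_cst|move=> n p; exact: (sgr_iter_cvg (gb p)).2].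
- by move=> p; exact: (sgr_iter_cvg (gb p)).1.
Qed.

(** For fixed [x = u p - b], once [|x| / (n + 1) < 2] the sine of [x / (n + 1)] has the sign of [x],
    since sine is positive on []0, 2[]. The sequence is thus eventually constant at each point. *)
Lemma multiplier_sg_coord b : multiplier (fun p => Num.sg (u p - b)).
Proof.
apply: (@multiplier_lim (fun n p => Num.sg (sin (n.+1%:R^-1 * (u p - b))))).
- by move=> n; apply: multiplier_sg; [exact: multiplier_sin|move=> p; exact: sin_max].
- exists (fun=> 1); first exact: growth_cst.
  by move=> n p; rewrite normr_sg; case: eqP.
- move=> p; apply: cvg_near_cst; set x := u p - b.
  have S (y : R) : 0 < y < 2 -> Num.sg (sin y) = 1 by move=> /sin2_gt0 /gtr0_sg.
  have B : \forall n \near \oo, n.+1%:R^-1 * `|x| < 2.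
    near=> n; rewrite mulrC ltr_pdivrMr// -ltr_pdivrMl//.
    rewrite (@lt_trans _ _ n%:R) ?ltr_nat//.
    by near: n; exact: nbhs_infty_gtr.
  apply: filterS B => n B; have n0 : (0 : R) < n.+1%:R^-1 by rewrite invr_gt0.
  case: (ltrgt0P x) B => [x0|x0|->] B.
  - by rewrite (gtr0_sg x0) S// B mulr_gt0.
  - by rewrite (ltr0_sg x0) -(opprK x) mulrN sinN sgrN S// B mulr_gt0// oppr_gt0.
  - by rewrite mulr0 sin0.
Unshelve. all: by end_near. Qed.

Lemma multiplier_ray b : multiplier (\1_(u @^-1` `]b, +oo[)).
Proof.
pose s p := Num.sg (u p - b).
(* For [s] in [{-1, 0, 1}], [(s^2 + s) / 2] is 1 exactly when [s = 1]. *)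
have -> : \1_(u @^-1` `]b, +oo[) = fun p => 2^-1 * (s p ^+ 2 + s p).
  apply/funext => p; rewrite indicE /s.
  have -> : (p \in u @^-1` `]b, +oo[) = (0 < u p - b).
    by rewrite subr_gt0; apply/idP/idP; rewrite inE /= in_itv /= andbT.
  case: ltrgt0P => [h|h|->].
  - by rewrite gtr0_sg// expr1n /=; field.
  - by rewrite ltr0_sg// sqrrN expr1n addrN mulr0.
  - by rewrite sgr0 expr0n addr0 mulr0.
have sm : multiplier s by exact: multiplier_sg_coord.
apply: multiplierM; first exact: multiplier_cst.
by apply: multiplierD => //; exact: multiplierX.
Qed.

(** The complement corresponds to [1 - \1_A], and a countable union to the limit of
    [1 - prod (1 - \1_(F i))]. Closure under products handles overlapping sets, so a full
    sigma-algebra is obtained directly. *)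
Lemma sigma_algebra_multiplier :
  sigma_algebra setT [set A : set (R * R) | multiplier \1_A].
Proof.
split=> [|A /= mA|F /= mF].
- by rewrite /= indic0; exact: multiplier_cst.
- have -> : \1_(setT `\` A) = (fun p => 1 + -1 * \1_A p) :> (R * R -> R).
    apply/funext => p; rewrite !indicE setTD in_setC.
    by case: (p \in A); rewrite /= ?mulr1 ?mulr0 ?subrr ?addr0.
  apply: multiplierD; first exact: multiplier_cst.
  by apply: multiplierM => //; exact: multiplier_cst.
- apply: (@multiplier_lim (fun n p => 1 + -1 * \prod_(0 <= i < n) (1 + -1 * \1_(F i) p))).
  + move=> n; apply: multiplierD; first exact: multiplier_cst.
    apply: multiplierM; first exact: multiplier_cst.
    elim: n => [|n ih]; first by under eq_fun do rewrite big_geq//; exact: multiplier_cst.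
    under eq_fun do rewrite big_nat_recr//=; apply: multiplierM => //.
    apply: multiplierD; first exact: multiplier_cst.
    by apply: multiplierM => //; exact: multiplier_cst.
  + exists (fun=> 1); first exact: growth_cst.
    move=> n p.
    suff : 0 <= \prod_(0 <= i < n) (1 + -1 * \1_(F i) p : R) <= 1.
      by move=> /andP[P0 P1]; rewrite mulN1r ger0_norm ?subr_ge0// gerBl.
    apply: (big_ind (fun x : R => 0 <= x <= 1)) => [|x y /andP[? ?] /andP[? ?]|i _].
    * by rewrite ler01 lexx.
    * by rewrite mulr_ge0//= mulr_ile1.
    * rewrite indicE; case: (p \in _);
        by rewrite /= ?mulr1 ?mulr0 ?subrr ?addr0 lexx ler01.
  + move=> p; apply: cvg_near_cst; rewrite (indicE _ (\bigcup_k F k)).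
    have [|pF] := boolP (p \in \bigcup_k F k).
      rewrite inE => -[k _ Fkp]; near=> n.
      have kn : (k < n)%N by near: n; exact: nbhs_infty_gt.
      rewrite (bigD1_seq k) ?iota_uniq ?mem_index_iota//=.
      by rewrite indicE mem_set// mulr1 subrr mul0r mulr0 addr0.
    apply: nearW => n; rewrite big1 ?mulr1 ?subrr// => i _.
    rewrite indicE memNset ?mulr0 ?addr0// => Fip; move/negP: pF; apply.
    by rewrite inE; exists i.
Unshelve. all: by end_near. Qed.

Lemma multiplier_preimage (B : set R) : measurable B -> multiplier \1_(u @^-1` B).
Proof.
have [S0 SC SU] := sigma_algebra_multiplier.
have : (R.-ocitv.-measurable).-sigma.-measurable `<=` [set B | multiplier \1_(u @^-1` B)].
  (* Open right rays generate the Borel sets, and preimages commute with the sigma-algebra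
     operations. *)
  rewrite RGenOInfty.measurableE; apply: smallest_sub.
    split => [|A /SC|F /SU] /=; rewrite ?preimage_set0 ?preimage_bigcup//.
  by move=> _ [x ->]; exact: multiplier_ray.
exact.
Qed.

End coordinate.

(** The constant 1 is a test function by [agree_zmon], so the multiplier [\1_A] makes [\1_A] one
    too. Its test against [w = 1], [j = k = 0] is the equality of the two measures of [A]. *)
Lemma measure_ext (A : set (R * R)) : measurable A -> mu A = nu A.
Proof.
move=> mA.
have Am : multiplier \1_A.
  have : measurable `<=` [set A : set (R * R) | multiplier \1_A].
    (* The product sigma-algebra is generated by preimages of Borel sets under the two
       projections. *)
    apply: smallest_sub; first exact: sigma_algebra_multiplier.
    move=> _ [[B mB <-]|[B mB <-]] /=; rewrite setTI; apply: multiplier_preimage => //.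
    - exact: multiplier_fst.
    - by move=> p; rewrite lerDl.
    - exact: multiplier_snd.
    - by move=> p; rewrite lerDr.
  exact.
have t1 : mtest (fun=> 1).
  split=> [|w j k]; first exact: growth_cst.
  by under [X in agree X]eq_fun do rewrite mul1r; exact: agree_zmon.
have [_ /(_ _ t1)[_ /(_ 1 0%N 0%N)]] := Am.
have Z p : complex.Re (zmon 1 0 0 p) = 1 :> R by rewrite /zmon !mulr1.
rewrite /agree; under eq_integral do rewrite mul1r Z mulr1.
under [RHS]eq_integral do rewrite mul1r Z mulr1.
by rewrite !integral_indic// !setIT.
Qed.

End uniqueness.

(** * Moments of the exponential distribution *)

Section density.
Local Open Scope ereal_scope.
Context d (T : measurableType d) (R : realType).
Variables (mu nu : {measure set T -> \bar R}) (g : T -> R).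
Hypotheses (mg : measurable_fun setT g) (g0 : forall x, (0 <= g x)%R).
Hypothesis nuE : forall A, measurable A -> nu A = \int[mu]_(x in A) (g x)%:E.

Import HBNNSimple.

Let ge0_integral_density_nnsfun (h : {nnsfun T >-> R}) :
  \int[nu]_x (h x)%:E = \int[mu]_x (h x * g x)%:E.
Proof.
under [LHS]eq_integral do rewrite fimfunE -fsumEFin//.
rewrite ge0_integral_fsum//; last 2 first.
- by move=> r; exact/measurable_EFinP/measurableT_comp.
- by move=> r x _; rewrite EFinM nnfun_muleindic_ge0.
have hE x : (h x * g x)%:E =
    \sum_(r \in range h) (r * \1_(h @^-1` [set r]) x * g x)%:E.
  by rewrite {1}(fimfunE h) !fsbig_finite//= mulr_suml sumEFin.
under [RHS]eq_integral do rewrite hE.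
rewrite ge0_integral_fsum//; last 2 first.
- move=> r; apply/measurable_EFinP; apply: measurable_funM => //.
  exact: measurable_funM.
- by move=> r x _; rewrite EFinM mule_ge0 ?lee_fin// -lee_fin EFinM nnfun_muleindic_ge0.
apply: eq_fsbigr => r _.
rewrite integralZl_indic_nnsfun//= integral_indic// setIT nuE//.
(* A negative [r] has an empty level set under the nonnegative [h], and both sides vanish. *)
have [r0|r0] := leP 0%R r; last first.
  rewrite preimage_nnfun0//.
  rewrite integral_set0 mule0 integral0_eq// => x _.
  by rewrite indic0 mulr0 mul0r.
rewrite -ge0_integralZl//; last 2 first.
- exact/measurable_EFinP/measurable_funTS.
- by move=> x _; rewrite lee_fin.
rewrite integral_mkcond; apply: eq_integral => x _.
rewrite patchE indicE; case: ifPn => _.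
  by rewrite mulr1.
by rewrite mulr0 mul0r.
Qed.

(** Simple functions increase to [f], and monotone convergence applies on both sides because [g] is
    nonnegative. *)
Lemma ge0_integral_density (f : T -> \bar R) : measurable_fun setT f ->
  (forall x, 0 <= f x) -> \int[nu]_x f x = \int[mu]_x (f x * (g x)%:E).
Proof.
move=> mf f0; pose f_ := nnsfun_approx measurableT mf.
have fE x : f x = lim ((f_ n x)%:E @[n --> \oo]).
  by apply/esym/cvg_lim => //; exact: cvg_nnsfun_approx.
have nd x : {homo (fun n => (f_ n x)%:E) : n m / (n <= m)%N >-> n <= m}.
  by move=> n m nm; rewrite lee_fin; exact/lefP/nd_nnsfun_approx.
transitivity (lim (\int[nu]_x (f_ n x)%:E @[n --> \oo])).
  rewrite -monotone_convergence//.
  - by apply: eq_integral => x _; rewrite fE.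
  - by move=> n; exact/measurable_EFinP.
  - by move=> n x _; rewrite lee_fin.
under eq_fun do rewrite ge0_integral_density_nnsfun.
rewrite -monotone_convergence//; last 3 first.
- by move=> n; apply/measurable_EFinP; exact: measurable_funM.
- by move=> n x _; rewrite lee_fin mulr_ge0.
- move=> x _ n m nm; rewrite lee_fin ler_wpM2r// -lee_fin; exact: nd.
apply: eq_integral => x _; apply/cvg_lim => //.
under eq_fun do rewrite EFinM.
by apply: cvgeZr => //; exact: cvg_nnsfun_approx.
Qed.

End density.

Section exponential_moments.
Context {R : realType}.
Local Notation leb := (@lebesgue_measure R).

(** The primitive of [t^n e^(-t)] that tends to 0 at infinity, built by repeated integration by
    parts. *)
Fixpoint gamma_prim (n : nat) (t : R) : R :=
  if n is m.+1 then - (t ^+ n * expR (- t)) + n%:R * gamma_prim m t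
  else - expR (- t).

Lemma is_derive_expRN (t : R) : is_derive t 1 (fun x => expR (- x)) (- expR (- t)).
Proof.
have -> : - expR (- t) = expR (- t) * -1 by rewrite mulrN1.
exact: (is_derive1_comp (f := expR) (g := -%R)).
Qed.

Lemma is_derive_gamma_prim n (t : R) :
  is_derive t 1 (gamma_prim n) (t ^+ n * expR (- t)).
Proof.
elim: n => [|n ih] /=.
  have := is_deriveN (is_derive_expRN t); rewrite opprK mul1r; exact.
have dX : is_derive t 1 (fun x : R => x ^+ n.+1) (n.+1%:R * t ^+ n).
  rewrite (_ : (fun x : R => x ^+ n.+1) = id ^+ n.+1); last first.
    by rewrite exprfctE.
  by apply: is_derive_eq; rewrite /GRing.scale /= mulr1.
have dM := is_deriveM dX (is_derive_expRN t).
have dN := is_deriveN dM.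
have dZ := is_deriveZ n.+1%:R ih.
apply: is_derive_eq (is_deriveD dN dZ) _.
by rewrite /GRing.scale /=; ring.
Qed.

Lemma gamma_prim0 n : gamma_prim n 0 = - n`!%:R :> R.
Proof.
elim: n => [|n ih] /=; first by rewrite oppr0 expR0.
by rewrite ih exprS !mul0r oppr0 add0r factS natrM mulrN.
Qed.

Lemma cvg_expn_expRN n : t ^+ n * expR (- t) @[t --> +oo] --> (0 : R).
Proof.
(* The majorant comes from [e^t >= t^(n+1) / (n+1)!], which gives [t^n e^(-t) <= (n+1)! / t]. *)
have H : n.+1`!%:R * t^-1 @[t --> +oo] --> (0 : R).
  rewrite -[X in _ --> X](mulr0 n.+1`!%:R); apply: cvgMl_tmp.
  by apply/(gtr0_cvgV0 (f := id)); [exact: nbhs_pinfty_gt|exact: cvg_id].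
apply: (squeeze_cvgr _ (cvg_cst 0) H); near=> t.
have t0 : 0 < t by near: t; exact: nbhs_pinfty_gt.
rewrite mulr_ge0 ?expR_ge0 ?exprn_ge0 ?(ltW t0)//=.
rewrite expRN ler_pdivrMr ?expR_gt0// mulrAC ler_pdivlMr// -exprSr.
rewrite -ler_pdivrMl ?ltr0n ?fact_gt0// mulrC.
by rewrite (le_trans _ (expR_ge1Dxn n (ltW t0)))// lerDr.
Unshelve. all: by end_near. Qed.

Lemma cvg_gamma_prim n : gamma_prim n t @[t --> +oo] --> (0 : R).
Proof.
elim: n => [|n ih] /=.
  by rewrite -[X in _ --> X]oppr0; apply: cvgN; exact: cvgr_expR.
rewrite -[X in _ --> X](addr0 0); apply: cvgD.
  by rewrite -[X in _ --> X]oppr0; apply: cvgN; exact: cvg_expn_expRN.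
by rewrite -[X in _ --> X](mulr0 n.+1%:R); apply: cvgMl_tmp.
Qed.

Lemma integral_expn_expRN n :
  (\int[leb]_(t in `[0%R, +oo[) (t ^+ n * expR (- t))%:E = n`!%:R%:E)%E.
Proof.
have dc (t : R) : {for t, continuous (gamma_prim n)}.
  apply: differentiable_continuous; apply/derivable1_diffP.
  by have [] := is_derive_gamma_prim n t.
rewrite (@ge0_continuous_FTC2y _ _ (gamma_prim n) 0 0).
- by rewrite gamma_prim0 EFinN oppeK add0e.
- by move=> t t0; rewrite mulr_ge0 ?expR_ge0 ?exprn_ge0.
- apply: continuous_subspaceT => t; apply: cvgM; first exact: exprn_continuous.
  by apply: continuous_comp; [exact: opp_continuous|exact: continuous_expR].
- exact: cvg_gamma_prim.
- by move=> t _; have [] := is_derive_gamma_prim n t.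
- by apply: cvg_at_right_filter; exact: dc.
- by move=> t _; rewrite derive1E; have [_ ->] := is_derive_gamma_prim n t.
Qed.

End exponential_moments.

(** * Parseval's identity on circles *)

Section parseval.
Context {R : realType}.
Local Notation leb := (@lebesgue_measure R).

Definition cis (r x : R) : R * R := (r * cos x, r * sin x).

Lemma toC_cisX (r x : R) n :
  toC (cis r x) ^+ n = Complex (r ^+ n * cos (n%:R * x)) (r ^+ n * sin (n%:R * x)).
Proof.
elim: n => [|n ih]; first by rewrite !mul0r cos0 sin0 expr0 mulr0 mulr1.
have -> : n.+1%:R * x = x + n%:R * x by rewrite mulrSr mulrDl mul1r addrC.
rewrite exprS ih; apply/eqP; rewrite eq_complex Re_mul Im_mul /= cosD sinD exprS.
by apply/andP; split; apply/eqP; ring.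
Qed.

(* A primitive is part of the data, so that [L] is found without any
   integrability side condition. *)
Definition hasint (f : R -> R) (L : R) := continuous f /\
  exists F : R -> R, (forall x : R, is_derive x 1 F (f x)) /\ F (pi *+ 2) - F 0 = L.

Lemma hasint_integral f L : hasint f L ->
  (\int[leb]_(x in `[0%R, (pi *+ 2)%R]) (f x)%:E = L%:E)%E.
Proof.
move=> [cf [F [dF FL]]].
have cF (x : R) : {for x, continuous F}.
  by apply: differentiable_continuous; apply/derivable1_diffP; have [] := dF x.
rewrite (@continuous_FTC2 _ _ F).
- by rewrite -EFinB FL.
- by rewrite mulr2n addr_gt0// pi_gt0.
- exact: continuous_subspaceT.
- split=> [x _||]; first by have [] := dF x.
    by apply: cvg_at_right_filter; exact: cF.
  by apply: cvg_at_left_filter; exact: cF.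
- by move=> x _; rewrite derive1E; have [_ ->] := dF x.
Qed.

Lemma hasintD f g L M : hasint f L -> hasint g M ->
  hasint (fun x => f x + g x) (L + M).
Proof.
move=> [cf [F [dF FL]]] [cg [G [dG GM]]]; split.
  by move=> x; apply: cvgD; [exact: cf|exact: cg].
exists (fun x => F x + G x); split; last by rewrite -FL -GM; ring.
by move=> x; exact: is_deriveD.
Qed.

Lemma hasintZ c f L : hasint f L -> hasint (fun x => c * f x) (c * L).
Proof.
move=> [cf [F [dF FL]]]; split.
  by move=> x; apply: cvgMl_tmp; exact: cf.
exists (fun x => c * F x); split; last by rewrite -FL; ring.
by move=> x; exact: (is_deriveZ c (dF x)).
Qed.

Lemma hasint_cst c : hasint (fun=> c) ((pi *+ 2) * c).
Proof.
split; first by move=> x; exact: cvg_cst.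
exists (fun x => c * x); split; last by ring.
by move=> x; apply: is_derive_eq (is_deriveZ c (is_derive_id x (1 : R))) _;
  rewrite /GRing.scale /= mulr1.
Qed.

Lemma is_derive_scale (f : R -> R) (k x df : R) :
  is_derive (k * x) 1 f df -> is_derive x 1 (fun y => f (k * y)) (df * k).
Proof.
move=> h; apply: (is_derive1_comp h).
apply: is_derive_eq (is_deriveZ k (is_derive_id x (1 : R))) _.
by rewrite /GRing.scale /= mulr1.
Qed.

Lemma cos_sin_2pin n : cos (n%:R * (pi *+ 2)) = 1 :> R /\ sin (n%:R * (pi *+ 2)) = 0 :> R.
Proof.
elim: n => [|n [c s]]; first by rewrite mul0r cos0 sin0.
have -> : n.+1%:R * (pi *+ 2) = n%:R * (pi *+ 2) + pi *+ 2 :> R.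
  by rewrite mulrSr mulrDl mul1r.
by rewrite cosD2pi sinD2pi.
Qed.

Lemma continuous_scale (f : R -> R) (k : R) : continuous f ->
  continuous (fun y : R => f (k * y)).
Proof.
move=> cf x; apply: (@continuous_comp _ _ _ (fun y => k * y) f); last exact: cf.
by apply: cvgMl_tmp; exact: cvg_id.
Qed.

Lemma hasint_cos n : (0 < n)%N -> hasint (fun x => cos (n%:R * x)) 0.
Proof.
move=> n0; have nn0 : n%:R != 0 :> R by rewrite pnatr_eq0 -lt0n.
split; first by apply: continuous_scale; exact: continuous_cos.
exists (fun x => n%:R^-1 * sin (n%:R * x)); split; last first.
  by rewrite (cos_sin_2pin n).2 !mulr0 sin0 mulr0 subrr.
move=> x; apply: is_derive_eq (is_deriveZ n%:R^-1 (is_derive_scale (is_derive_sin _))) _.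
by rewrite /GRing.scale /= mulrCA mulVf// mulr1.
Qed.

Lemma hasint_sin n : (0 < n)%N -> hasint (fun x => sin (n%:R * x)) 0.
Proof.
move=> n0; have nn0 : n%:R != 0 :> R by rewrite pnatr_eq0 -lt0n.
split; first by apply: continuous_scale; exact: continuous_sin.
exists (fun x => - n%:R^-1 * cos (n%:R * x)); split; last first.
  by rewrite (cos_sin_2pin n).1 mulr0 cos0 subrr.
move=> x.
apply: is_derive_eq (is_deriveZ (- n%:R^-1) (is_derive_scale (is_derive_cos _))) _.
by rewrite /GRing.scale /=; field.
Qed.

(** Adding the term of index [N] adds its own square, constant on the circle, and a cross term with
    the earlier terms, whose integral vanishes by orthogonality. *)
Lemma hasint_partial (c : nat -> R[i]) r N :
  hasint (fun x => cabs2 (\sum_(n < N) c n * toC (cis r x) ^+ n))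
    ((pi *+ 2) * \sum_(n < N) cabs2 (c n) * (r ^+ 2) ^+ n).
Proof.
elim: N => [|N ih].
  under eq_fun do rewrite big_ord0; rewrite big_ord0.
  have -> : cabs2 (0 : R[i]) = 0 :> R by rewrite /cabs2 /= expr0n addr0.
  exact: hasint_cst.
have cabs_cis x : cabs2 (toC (cis r x)) = r ^+ 2.
  by rewrite /cabs2 /= !exprMn -mulrDr cos2Dsin2 mulr1.
have -> : (fun x => cabs2 (\sum_(n < N.+1) c n * toC (cis r x) ^+ n)) = fun x =>
  (cabs2 (\sum_(n < N) c n * toC (cis r x) ^+ n) + cabs2 (c N) * (r ^+ 2) ^+ N) +
  2 * complex.Re ((\sum_(n < N) c n * toC (cis r x) ^+ n) *
    ((c N * toC (cis r x) ^+ N)^*)%C).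
  by apply/funext => x; rewrite big_ord_recr/= cabs2D cabs2M cabs2X cabs_cis.
rewrite big_ord_recr/= mulrDr -[X in hasint _ X]addr0 -[X in hasint _ (_ + X)](mulr0 2).
apply: hasintD; first by apply: hasintD => //; exact: hasint_cst.
apply: hasintZ.
(* An inner induction on the number [M] of earlier terms keeps [c N] fixed, with [M <= N] ensuring
   that all frequency differences are positive. *)
have H M : (M <= N)%N -> hasint (fun x => complex.Re
   ((\sum_(n < M) c n * toC (cis r x) ^+ n) * ((c N * toC (cis r x) ^+ N)^*)%C)) 0.
  elim: M => [_|M ihM MN].
    under eq_fun do rewrite big_ord0 mul0r /=.
    by rewrite -[X in hasint _ X](mulr0 (pi *+ 2)); exact: hasint_cst.
  under eq_fun do rewrite big_ord_recr/= mulrDl Re_add.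
  rewrite -[X in hasint _ X](addr0 0); apply: hasintD; first by apply: ihM; exact: ltnW.
  pose d : R[i] := c M * ((c N)^*)%C.
  (* This is the real part of [r^(M+N) d e^(-i (N-M) x)]. *)
  have -> : (fun x => complex.Re (c M * toC (cis r x) ^+ M *
      ((c N * toC (cis r x) ^+ N)^*)%C)) =
    fun x => (r ^+ (M + N) * complex.Re d) * cos ((N - M)%:R * x) +
             (r ^+ (M + N) * complex.Im d) * sin ((N - M)%:R * x).
    apply/funext => x; rewrite !toC_cisX natrB ?(ltnW MN)// mulrBl cosB sinB exprD /d.
    by rewrite !(Re_mul, Im_mul, Re_conj, Im_conj) /=; ring.
  have := hasintD (hasintZ (r ^+ (M + N) * complex.Re d) (@hasint_cos (N - M) _))
    (hasintZ (r ^+ (M + N) * complex.Im d) (@hasint_sin (N - M) _)).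
  by rewrite !mulr0 addr0 subn_gt0; exact.
exact: H.
Qed.

End parseval.

(** * Entire functions: bounds, measurability and Parseval's identity *)

Section power_series.
Context {R : realType} (c : nat -> R[i]) (F : R[i] -> R[i]).
Hypothesis cF : entire_series c F.
Local Notation normc := (@Normc.normc R).
Local Notation leb := (@lebesgue_measure R).

Lemma cabs2_normc (z : R[i]) : cabs2 z = normc z ^+ 2.
Proof. by case: z => x y; rewrite /cabs2 /= sqr_sqrtr// addr_ge0 ?sqr_ge0. Qed.

Lemma normc_ge0 (z : R[i]) : 0 <= normc z.
Proof. by case: z => x y; rewrite sqrtr_ge0. Qed.

Lemma normc_le (z : R[i]) : normc z <= `|complex.Re z| + `|complex.Im z|.
Proof.
rewrite -ler_sqr ?nnegrE ?normc_ge0 ?addr_ge0// -cabs2_normc /cabs2.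
rewrite sqrrD !real_normK ?num_real// lerD2r lerDl.
by rewrite mulrn_wge0// mulr_ge0.
Qed.

Lemma normcX (z : R[i]) n : normc (z ^+ n) = normc z ^+ n.
Proof.
by elim: n => [|n ih]; rewrite ?expr0 ?Normc.normc1// !exprS Normc.normcM ih.
Qed.

(** The series converges at the real point [s], so its partial sums are bounded, and each term is a
    difference of two consecutive ones. Real and imaginary parts contribute [A + A] and
    [A' + A']. *)
Lemma coef_bound (s : R) : 0 <= s ->
  exists2 M, 0 <= M & forall n, normc (c n) * s ^+ n <= M.
Proof.
move=> s0; have [cR cI] := cF (Complex s 0).
have B (u : R^nat) (l : R) : u @ \oo --> l -> exists A, forall n, `|u n| <= A.
  move=> ul; have /cvg_seq_bounded [A [_ hA]] : cvgn u by apply/cvg_ex; exists l.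
  by exists (A + 1) => n; apply: hA => //; rewrite ltrDl.
have [A hA] := B _ _ cR; have [A' hA'] := B _ _ cI.
have A0 := le_trans (normr_ge0 _) (hA 0%N).
have A0' := le_trans (normr_ge0 _) (hA' 0%N).
exists (A + A + (A' + A')); first by rewrite !addr_ge0.
move=> n; have -> : normc (c n) * s ^+ n = normc (c n * (Complex s 0) ^+ n).
  rewrite Normc.normcM normcX; congr (_ * _ ^+ _).
  by rewrite /= expr0n addr0 sqrtr_sqr ger0_norm.
apply: le_trans (normc_le _) _; apply: lerD.
- have := lerD (hA n.+1) (hA n); apply: le_trans.
  rewrite big_ord_recr /= Re_add; set S := \sum_(_ < _) _.
  by apply: le_trans (ler_normB _ _); rewrite addrAC subrr add0r.
- have := lerD (hA' n.+1) (hA' n); apply: le_trans.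
  rewrite big_ord_recr /= Im_add; set S := \sum_(_ < _) _.
  by apply: le_trans (ler_normB _ _); rewrite addrAC subrr add0r.
Qed.

Lemma normc_cis (r x : R) : normc (toC (cis r x)) = `|r|.
Proof. by rewrite /= !exprMn -mulrDr cos2Dsin2 mulr1 sqrtr_sqr. Qed.

(** At the larger radius [s = |r| + 1] the terms are bounded by some [M], so on radius [r] they are
    at most [M q^n] with [q = |r| / s < 1]. The bound is uniform in [N] and in the angle, as
    dominated convergence requires. *)
Lemma partial_bound (r : R) : exists B, forall N x,
  cabs2 (\sum_(n < N) c n * toC (cis r x) ^+ n) <= B.
Proof.
pose s := `|r| + 1; have s0 : 0 < s by rewrite ltr_wpDl.
have [M M0 hM] := coef_bound (ltW s0).
pose q := `|r| / s.
have q0 : 0 <= q by rewrite divr_ge0// ltW.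
have q1 : `|q| < 1 by rewrite ger0_norm// ltr_pdivrMr// mul1r ltrDl.
exists ((M * limn (series (geometric 1 q))) ^+ 2) => N x.
have -> : cabs2 (\sum_(n < N) c n * toC (cis r x) ^+ n) =
  normc (\sum_(n < N) c n * toC (cis r x) ^+ n) ^+ 2 by rewrite cabs2_normc.
apply: lerXn2r; rewrite ?nnegrE ?normc_ge0//.
  rewrite mulr_ge0// (le_trans _ (nondecreasing_cvgn_le _ _ 0%N))//.
  - by rewrite /series/= big_geq.
  - by apply: nondecreasing_series => i _ _; rewrite /geometric /= mul1r exprn_ge0.
  - exact: is_cvg_geometric_series.
apply: (@le_trans _ _ (\sum_(n < N) normc (c n * toC (cis r x) ^+ n))).
  elim: N => [|N ih]; first by rewrite !big_ord0 Normc.normc0.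
  by rewrite !big_ord_recr/= (le_trans (le_normcD _ _))// lerD2r.
apply: (@le_trans _ _ (M * series (geometric 1 q) N)).
  rewrite /series /= big_mkord mulr_sumr ler_sum// => i _.
  rewrite Normc.normcM normcX normc_cis mul1r /q expr_div_n mulrA.
  by rewrite ler_pdivlMr ?exprn_gt0// mulrAC ler_wpM2r ?exprn_ge0.
rewrite ler_wpM2l// nondecreasing_cvgn_le//.
- by apply: nondecreasing_series => i _ _; rewrite /geometric /= mul1r exprn_ge0.
- exact: is_cvg_geometric_series.
Qed.

Lemma cvg_cabs2 (z : R[i]) :
  cabs2 (\sum_(n < N) c n * z ^+ n) @[N --> \oo] --> cabs2 (F z).
Proof.
have [cR cI] := cF z; apply: cvgD.
  by under eq_fun do rewrite expr2; rewrite expr2; exact: cvgM.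
by under eq_fun do rewrite expr2; rewrite expr2; exact: cvgM.
Qed.

Lemma measurable_partial N :
  measurable_fun setT (fun p => complex.Re (\sum_(n < N) c n * toC p ^+ n)) /\
  measurable_fun setT (fun p => complex.Im (\sum_(n < N) c n * toC p ^+ n)).
Proof.
elim: N => [|N [ihR ihI]].
  by split; under eq_fun do rewrite big_ord0; exact: measurable_cst.
have zE : zmon (c N) N 0 = fun p => c N * toC p ^+ N.
  by apply/funext => p; rewrite /zmon mulr1.
have [[mR _] [mI _]] := growth_zmon (c N) N 0; rewrite zE in mR mI.
split.
- by under eq_fun do rewrite big_ord_recr/= Re_add; exact: measurable_funD.
- by under eq_fun do rewrite big_ord_recr/= Im_add; exact: measurable_funD.
Qed.

Lemma measurable_Re_entire : measurable_fun setT (fun p => complex.Re (F (toC p))).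
Proof.
apply: (measurable_fun_cvg
  (h := fun N p => complex.Re (\sum_(n < N) c n * toC p ^+ n))).
  by move=> N; case: (measurable_partial N).
by move=> p _; case: (cF (toC p)).
Qed.

Lemma measurable_Im_entire : measurable_fun setT (fun p => complex.Im (F (toC p))).
Proof.
apply: (measurable_fun_cvg
  (h := fun N p => complex.Im (\sum_(n < N) c n * toC p ^+ n))).
  by move=> N; case: (measurable_partial N).
by move=> p _; case: (cF (toC p)).
Qed.

Lemma measurable_cabs2_entire : measurable_fun setT (fun p => cabs2 (F (toC p))).
Proof.
apply: (@measurable_funD _ _ _ setT (fun p => complex.Re (F (toC p)) ^+ 2)
  (fun p => complex.Im (F (toC p)) ^+ 2)).
  by apply: (@measurable_funX _ _ _ setT (fun p => complex.Re (F (toC p))));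
    exact: measurable_Re_entire.
by apply: (@measurable_funX _ _ _ setT (fun p => complex.Im (F (toC p))));
  exact: measurable_Im_entire.
Qed.

Lemma pi2_gt0 : (0 : R) < pi *+ 2.
Proof. by rewrite mulr2n addr_gt0// pi_gt0. Qed.

Lemma measurable_cis (r : R) : measurable_fun setT (cis r).
Proof.
apply/measurable_fun_pairP; split; apply: measurable_funM => //.
- by apply: continuous_measurable_fun; exact: continuous_cos.
- by apply: continuous_measurable_fun; exact: continuous_sin.
Qed.

(** The identity holds for partial sums, which are uniformly bounded on the circle. Dominated
    convergence passes to the limit, and the density [1 / (2 pi)] cancels the length of the
    interval. *)
Lemma parseval (r : R) :
  (\int[uniform_prob pi2_gt0]_x (cabs2 (F (toC (cis r x))))%:E =
   \sum_(0 <= n <oo) (cabs2 (c n) * (r ^+ 2) ^+ n)%:E)%E.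
Proof.
have mF : measurable_fun setT (fun x => cabs2 (F (toC (cis r x)))).
  exact: measurableT_comp measurable_cabs2_entire (measurable_cis r).
rewrite integral_uniform; last 2 first.
- exact/measurable_EFinP.
- by move=> x; rewrite lee_fin cabs2_ge0.
have mN N : measurable_fun setT
    (fun x => cabs2 (\sum_(n < N) c n * toC (cis r x) ^+ n)).
  by apply: continuous_measurable_fun; case: (hasint_partial c r N).
have [B hB] := partial_bound r.
have [|||||_ _ H] := @dominated_convergence _ _ _ leb `[0, pi *+ 2] (measurable_itv _)
  (fun N x => (cabs2 (\sum_(n < N) c n * toC (cis r x) ^+ n))%:E)
  (fun x => (cabs2 (F (toC (cis r x))))%:E) (fun=> B%:E).
- move=> N; apply: measurable_funTS; apply/measurable_EFinP; exact: mN.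
- apply: measurable_funTS; apply/measurable_EFinP; exact: mF.
- apply: aeW => x _; apply: cvg_EFin; first by apply: nearW => ?.
  exact: cvg_cabs2.
- apply/integrableP; split; first exact: measurable_cst.
  rewrite integral_cst//= lebesgue_measure_itv/= lte_fin pi2_gt0 -EFinB -EFinM.
  exact: ltry.
- by apply: aeW => x N _; rewrite gee0_abs ?lee_fin ?cabs2_ge0//; exact: hB.
rewrite -(cvg_lim _ H)// -limeMl//; last first.
- exact: cvgP H.
congr (limn _); apply/funext => N /=.
rewrite (hasint_integral (hasint_partial c r N)) -EFinM subr0 mulKf ?gt_eqF ?pi2_gt0//.
by rewrite sumEFin big_mkord.
Qed.

End power_series.

(** * Existence *)

Section existence.
Context {R : realType} (a : R) (ha : 0 < a).

(** The radius satisfies [r t ^+ 2 = a * t] for [t >= 0], where the exponential law lives. *)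
Let r (t : R) := Num.sqrt (a * t).

Lemma measurable_radius : measurable_fun setT r.
Proof.
apply: (@measurableT_comp _ _ _ _ _ _ (@Num.sqrt R) setT (fun t => a * t)).
  by apply: continuous_measurable_fun; exact: sqrt_continuous.
exact: measurable_funM.
Qed.

(** For [T] exponential with parameter 1, [(a T)^n] has mean [a^n n!]. *)
Lemma radial_moments : exists rho : probability (measurableTypeR R) R,
  forall n, (\int[rho]_t ((r t ^+ 2) ^+ n)%:E = (lam a n)%:E)%E.
Proof.
unshelve eexists (exponential_prob (1 : R) : probability _ R); first exact: ltr01.
move=> n; rewrite (@ge0_integral_density _ _ _ lebesgue_measure _ (exponential_pdf 1)).
- transitivity (\int[lebesgue_measure]_(t in `[0%R, +oo[)
      ((a ^+ n)%:E * (t ^+ n * expR (- t))%:E))%E.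
    rewrite [RHS]integral_mkcond; apply: eq_integral => t _.
    rewrite -EFinM /exponential_pdf !patchE; case: ifPn => [|_]; last by rewrite mulr0.
    rewrite inE /= in_itv /= andbT => t0; rewrite mul1r mulN1r /r.
    by rewrite sqr_sqrtr ?mulr_ge0 ?(ltW ha)// exprMn -EFinM mulrA.
  rewrite ge0_integralZl//.
  + by rewrite integral_expn_expRN -EFinM.
  + apply/measurable_EFinP; apply: measurable_funTS; apply: measurable_funM.
      exact: measurable_funX.
    by apply: measurableT_comp => //; exact: measurable_funN.
  + move=> t; rewrite /= in_itv /= andbT => t0.
    by rewrite lee_fin mulr_ge0 ?expR_ge0 ?exprn_ge0.
  + by rewrite lee_fin exprn_ge0// ltW.
- exact: measurable_exponential_pdf.
- by move=> x; exact: exponential_pdf_ge0.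
- by [].
- apply/measurable_EFinP; do 2 apply: measurable_funX; exact: measurable_radius.
- by move=> x; rewrite lee_fin exprn_ge0// sqr_ge0.
Qed.

Lemma exists_HL2 : exists mu : {measure set (R * R) -> \bar R}, HL2_equal a mu.
Proof.
have [rho rhoE] := radial_moments.
pose m := (rho \x uniform_prob (@pi2_gt0 R))%E.
pose phi (p : R * R) := cis (r p.1) p.2.
have mphi : measurable_fun setT phi.
  have mr : measurable_fun setT (fun p : R * R => r p.1).
    exact: measurableT_comp measurable_radius measurable_fst.
  apply/measurable_fun_pairP; split; apply: measurable_funM => //.
  - apply: measurableT_comp measurable_snd.
    by apply: continuous_measurable_fun; exact: continuous_cos.
  - apply: measurableT_comp measurable_snd.
    by apply: continuous_measurable_fun; exact: continuous_sin.
unshelve eexists (pushforward m phi : {measure set _ -> \bar R}); first exact: mphi.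
move=> c F cF.
have mF := measurable_cabs2_entire cF.
(* Everything is nonnegative, so this equality holds in the extended reals and yields both the
   membership criterion and the equality of norms. *)
have E : (\int[pushforward m phi]_p (cabs2 (F (toC p)))%:E = Hnorm2 a c)%E.
  rewrite ge0_integral_pushforward//; last 2 first.
  - exact/measurable_EFinP.
  - by move=> p _; rewrite lee_fin cabs2_ge0.
  rewrite preimage_setT /m fubini_tonelli1; last 2 first.
  - apply/measurable_EFinP; exact: measurableT_comp mF mphi.
  - by move=> p; rewrite lee_fin cabs2_ge0.
  (* At fixed [t] the integral over the angle is Parseval's identity on the circle of radius
     [r t]. *)
  under eq_integral do rewrite [fubini_F _ _ _](parseval cF (r _)).
  have mX n : measurable_fun setT (fun t => (r t ^+ 2) ^+ n).
    by do 2 apply: measurable_funX; exact: measurable_radius.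
  rewrite integral_nneseries//; last 2 first.
  - move=> n; apply/measurable_EFinP.
    by apply: measurable_funM; [exact: measurable_cst|exact: mX].
  - by move=> n t _; rewrite lee_fin mulr_ge0 ?cabs2_ge0// exprn_ge0// sqr_ge0.
  apply: eq_eseriesr => n _; under eq_integral do rewrite EFinM.
  rewrite ge0_integralZl//.
  + by rewrite rhoE -EFinM mulrC.
  + by apply/measurable_EFinP; exact: mX.
  + by move=> t _; rewrite lee_fin exprn_ge0// sqr_ge0.
  + by rewrite lee_fin cabs2_ge0.
rewrite /inL2 E; split => //; split=> [h|[_ [_ //]]].
split; first exact: measurable_Re_entire cF.
by split=> //; exact: measurable_Im_entire cF.
Qed.

End existence.

Theorem theorem4p8 (R : realType) (a : R) (ha : 0 < a) :
  exists mu : {measure set (R * R) -> \bar R},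
    HL2_equal a mu /\
    forall mu' : {measure set (R * R) -> \bar R}, HL2_equal a mu' ->
      forall A : set (R * R), measurable A -> mu' A = mu A.
Proof.
have [mu muE] := exists_HL2 ha.
exists mu; split=> // nu nuE A mA.
exact (measure_ext ha nuE muE mA).
Qed.
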